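(* Let $A$ be a $C^*$-algebra with a faithful state $\omega_A$ whose GNS vector $\Omega_A$ is separating for $\pi_A(A)''$. Let $K_B$ be a finite dimensional Hilbert space, $B=\mathcal{B}(K_B)$, $\varrho$ an invertible density matrix on $K_B$ and $\omega_B(b)=\mathrm{Tr}(b\varrho)$. Let $\mathcal{P}$ be the natural cone of $(\pi(A\otimes B)'',\Omega)$, where $(H,\pi,\Omega)=(H_A\otimes H_B,\pi_A\otimes\pi_B,\Omega_A\otimes\Omega_B)$ is the GNS triple of $(A\otimes B,\omega_A\otimes\omega_B)$. Then $(\mathbb{I}\otimes U_B)\mathcal{P}=\mathcal{P}'$, where $\mathcal{P}'$ is the natural cone associated with the von Neumann algebra $\pi_A(A)''\otimes\pi_B(B)'$ and the vector $\Omega$.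
   Context: $(H_A,\pi_A,\Omega_A)$ and $(H_B,\pi_B,\Omega_B)$ are the GNS triples of $(A,\omega_A)$ and $(B,\omega_B)$. $H_B$ is identified with $\mathcal{B}(K_B)$ with inner product $\mathrm{Tr}(a^*b)$, $\pi_B$ with left multiplication, $\Omega_B=\varrho^{1/2}$. If $(f_k)$ is an orthonormal basis of $K_B$ consisting of eigenvectors of $\varrho$ and $F_{kl}=|f_k\rangle\langle f_l|$, then $U_B$ is the unitary on $H_B$ with $U_BF_{kl}=F_{lk}$. For a von Neumann algebra $\mathcal{N}$ with cyclic and separating vector $\Omega$ and modular conjugation $J$, the natural cone is the closure of $\{x\,JxJ\,\Omega:x\in\mathcal{N}\}$. *)

(* Defs.v *)
From HB Require Import structures.
From mathcomp Require Import all_boot all_order all_algebra.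
From mathcomp Require Import all_classical all_reals all_analysis.
From mathcomp Require Import complex.

Set Implicit Arguments.
Unset Strict Implicit.
Unset Printing Implicit Defensive.

Import Order.TTheory GRing.Theory Num.Theory.
Import numFieldNormedType.Exports.

Local Open Scope classical_set_scope.
Local Open Scope ring_scope.

Record hilbert (R : realType) := Hilbert {
  hilbert_sort :> completeNormedModType R[i];
  inner : {dot hilbert_sort for (@Num.conj R[i])};
  innerE : forall x, inner x x = `|x| ^+ 2
}.

(* MathComp forms are linear on the left; [braket] is the inner product that
   is conjugate-linear on the left and linear on the right. *)
Definition braket (R : realType) (H : hilbert R) (x y : H) : R[i] :=
  inner H y x.

(* not necessarily unital; MathComp rings all have a unit, hence the explicit
   product *)
Record cstarAlg (R : realType) := CstarAlg {
  cstar_sort :> completeNormedModType R[i];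
  cmul : {bilinear cstar_sort -> cstar_sort -> cstar_sort};
  cadj : cstar_sort -> cstar_sort;
  cmulA : forall a b c, cmul a (cmul b c) = cmul (cmul a b) c;
  cnormM : forall a b, `|cmul a b| <= `|a| * `|b|;
  cadjD : forall a b, cadj (a + b) = cadj a + cadj b;
  cadjZ : forall (z : R[i]) a, cadj (z *: a) = z^* *: cadj a;
  cadjM : forall a b, cadj (cmul a b) = cmul (cadj b) (cadj a);
  cadjK : forall a, cadj (cadj a) = a;
  cstarE : forall a, `|cmul (cadj a) a| = `|a| ^+ 2
}.

Section states.
Context {R : realType} {A : cstarAlg R}.

Record state (omega : A -> R[i]) : Prop := State {
  state_linear : scalar omega;
  state_pos : forall a, 0 <= omega (cmul A (cadj a) a);
  state_le1 : forall a, `|omega a| <= `|a|;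
  state_norm1 : forall e : R[i], 0 < e ->
    exists a : A, `|a| <= 1 /\ 1 - e < `|omega a|
}.

Definition faithful (omega : A -> R[i]) : Prop :=
  forall a, omega (cmul A (cadj a) a) = 0 -> a = 0.

End states.

Section bounded_operators.
Context {R : realType}.

Definition bop_pred (H : hilbert R) : {pred H -> H} :=
  mem [set T : H -> H | linear T /\ continuous T].
Arguments bop_pred H : clear implicits.

Lemma bop_submod_closed (H : hilbert R) : submod_closed (bop_pred H).
Proof.
split.
- rewrite inE; split; last by move=> x; exact: cvg_cst.
  by move=> k x y; rewrite scaler0 addr0.
- move=> k S T; rewrite !inE => -[lS cS] [lT cT]; split.
  + move=> c x y; change (k *: S (c *: x + y) + T (c *: x + y) =
      c *: (k *: S x + T x) + (k *: S y + T y)).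
    rewrite lS lT !scalerDr !scalerA (mulrC k c) -!addrA; congr (_ + _).
    by rewrite addrCA.
  + move=> x; apply: cvgD; last exact: cT.
    by apply: cvgZr; exact: cS.
Qed.

HB.instance Definition _ (H : hilbert R) :=
  GRing.isSubmodClosed.Build _ _ (bop_pred H) (@bop_submod_closed H).

Record bop (H : hilbert R) := Bop {
  bop_fun :> H -> H;
  bopP : bop_fun \in bop_pred H }.

HB.instance Definition _ (H : hilbert R) := [isSub for @bop_fun H].
HB.instance Definition _ (H : hilbert R) := [Choice of bop H by <:].
HB.instance Definition _ (H : hilbert R) :=
  [SubChoice_isSubLmodule of bop H by <:].

Lemma bopE (H : hilbert R) (T : bop H) : linear T /\ continuous T.
Proof. by have := bopP T; rewrite inE. Qed.

Definition mkbop (H : hilbert R) (T : H -> H) (hT : linear T /\ continuous T) :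
  bop H := Bop (mem_set hT : T \in bop_pred H).

Lemma bop_comp_subproof (H : hilbert R) (S T : bop H) :
  linear (S \o T) /\ continuous (S \o T).
Proof.
have [[lS cS] [lT cT]] := (bopE S, bopE T); split.
  by move=> k x y /=; rewrite lT lS.
by move=> x; apply: continuous_comp; [exact: cT|exact: cS].
Qed.

Definition bop_comp (H : hilbert R) (S T : bop H) : bop H :=
  mkbop (bop_comp_subproof S T).

Lemma bop_id_subproof (H : hilbert R) : linear (@id H) /\ continuous (@id H).
Proof. by split=> // x; exact: cvg_id. Qed.

Definition bop_id (H : hilbert R) : bop H := mkbop (bop_id_subproof H).

(* The adjoint exists, and is unique, by the Riesz representation theorem. *)
Definition adjoint (H : hilbert R) (T : bop H) : bop H :=
  xget 0 [set S : bop H | forall x y, braket (T x) y = braket x (S y)].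

Definition unitary (H : hilbert R) (U : bop H) : Prop :=
  (forall x y, braket (U x) (U y) = braket x y) /\ range U = setT.

Definition positive_op (H : hilbert R) (T : bop H) : Prop :=
  forall x, 0 <= braket x (T x).

Definition invertible_op (H : hilbert R) (T : bop H) : Prop :=
  exists S : bop H, bop_comp S T = bop_id H /\ bop_comp T S = bop_id H.

Definition commutant (H : hilbert R) (X : set (bop H)) : set (bop H) :=
  [set T | forall S, X S -> bop_comp S T = bop_comp T S].

Definition bicommutant (H : hilbert R) (X : set (bop H)) : set (bop H) :=
  commutant (commutant X).

Definition separating (H : hilbert R) (M : set (bop H)) (Omega : H) : Prop :=
  forall T, M T -> T Omega = 0 -> T = 0.

End bounded_operators.

(* The *-algebra is given by its product [mul] and involution [star], so that
   the notion applies to a [cstarAlg] as well as to B(K). *)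
Record gns_triple (R : realType) (A : lmodType R[i]) (mul : A -> A -> A)
    (star : A -> A) (omega : A -> R[i]) (H : hilbert R)
    (pi : {linear A -> bop H}) (Omega : H) : Prop := GnsTriple {
  gnsM : forall a b, pi (mul a b) = bop_comp (pi a) (pi b);
  gns_star : forall a, pi (star a) = adjoint (pi a);
  gns_cyclic : closure (range (fun a => pi a Omega)) = setT;
  gns_vector : forall a, omega a = braket Omega (pi a Omega)
}.

Section finite_dimension.
Context {R : realType} {K : hilbert R}.

Definition orthonormal_basis (n : nat) (f : 'I_n -> K) : Prop :=
  (forall k l, braket (f k) (f l) = (k == l)%:R) /\
  (forall x, x = \sum_k braket (f k) x *: f k).

(* the trace computed in an orthonormal basis f; it does not depend on f *)
Definition trace (n : nat) (f : 'I_n -> K) (T : bop K) : R[i] :=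
  \sum_k braket (f k) (T (f k)).

Definition eigenvector (T : bop K) (x : K) : Prop :=
  x != 0 /\ exists c : R[i], T x = c *: x.

Lemma braket_cauchy_schwarz (x y : K) : `|braket y x| <= `|y| * `|x|.
Proof.
rewrite /braket; have [->|y0] := eqVneq y 0.
  by rewrite linear0r normr0 normr0 mul0r.
have iy : inner K y y != 0 by rewrite dnorm_eq0.
pose a := inner K x y / inner K y y; pose z := x - a *: y.
have zy : inner K z y = 0.
  by rewrite linearBl/= linearZl_LR/= divfK ?subrr.
have xE : inner K x x = inner K z z + `|a| ^+ 2 * inner K y y.
  rewrite -dnormZ -[in LHS](subrK (a *: y) x) -/z hnormDd//.
  by rewrite linearZr_LR/= zy mulr0.
rewrite -(@ler_pXn2r _ 2)// ?nnegrE ?mulr_ge0//.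
rewrite exprMn -!innerE mulrC xE mulrDl.
have -> : `|inner K x y| ^+ 2 = `|a| ^+ 2 * inner K y y * inner K y y.
  have -> : inner K x y = a * inner K y y by rewrite divfK.
  by rewrite normrM exprMn (ger0_norm (dnorm_ge0 _ _)) -mulrA -expr2.
by rewrite lerDr mulr_ge0// dnorm_ge0.
Qed.

Lemma ketbra_subproof (x y : K) : linear (fun z : K => braket y z *: x) /\
  continuous (fun z : K => braket y z *: x).
Proof.
have lin : linear (fun z : K => braket y z *: x).
  by move=> k u v; rewrite /braket linearPl/= scalerDl scalerA.
split=> //.
pose g := GRing.isLinear.Build _ _ _ _ _ lin.
pose f : {linear K -> K} := HB.pack (fun z : K => braket y z *: x) g.
apply: (@bounded_linear_continuous _ _ _ f); apply/linear_boundedP.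
near=> r => z /=; rewrite normrZ.
rewrite (@le_trans _ _ (`|y| * `|z| * `|x|))//.
  by rewrite ler_wpM2r// braket_cauchy_schwarz.
rewrite mulrAC ler_wpM2r//; near: r; exact: nbhs_pinfty_ge.
Unshelve. all: by end_near. Qed.

Definition ketbra (x y : K) : bop K := mkbop (ketbra_subproof x y).

End finite_dimension.

Section tensor.
Context {R : realType} {H1 H2 H : hilbert R}.

(* (H, tau) is the Hilbert space tensor product of H1 and H2. *)
Record hilbert_tensor (tau : {bilinear H1 -> H2 -> H}) : Prop := HilbertTensor {
  tensor_braket : forall x y x' y',
    braket (tau x y) (tau x' y') = braket x x' * braket y y';
  tensor_dense : closure [set z | exists (m : nat) (x : 'I_m -> H1)
    (y : 'I_m -> H2), z = \sum_i tau (x i) (y i)] = setT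
}.

Variable tau : {bilinear H1 -> H2 -> H}.

(* S (x) T, the unique bounded operator mapping x (x) y to S x (x) T y *)
Definition tensor_op (S : bop H1) (T : bop H2) : bop H :=
  xget 0 [set W : bop H | forall x y, W (tau x y) = tau (S x) (T y)].

(* (pi1 (x) pi2)(A (x) B) for the algebraic tensor product of A and B; this is
   the C*-tensor product when B is finite dimensional. *)
Definition tensor_image (A B : lmodType R[i]) (pi1 : A -> bop H1)
    (pi2 : B -> bop H2) : set (bop H) :=
  [set W | exists (m : nat) (a : 'I_m -> A) (b : 'I_m -> B),
    W = \sum_i tensor_op (pi1 (a i)) (pi2 (b i))].

Definition vn_tensor (M : set (bop H1)) (N : set (bop H2)) : set (bop H) :=
  bicommutant [set W | exists S T, [/\ M S, N T & W = tensor_op S T]].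

End tensor.

Section modular.
Context {R : realType} {H : hilbert R}.

(* Unbounded operators are represented by their graphs. *)

Definition graph_adjoint (D : set (H * H)) : set (H * H) :=
  [set u | forall v, D v -> braket u.2 v.1 = braket u.1 v.2].

(* [D = graph_adjoint D] makes D a closed linear relation; a self-adjoint
   relation which is single-valued is a densely defined operator. *)
Definition positive_selfadjoint (D : set (H * H)) : Prop :=
  [/\ D = graph_adjoint D,
      (forall y, D (0, y) -> y = 0) &
      (forall u, D u -> 0 <= braket u.1 u.2)].

Definition antiunitary (J : H -> H) : Prop :=
  [/\ (forall (c : R[i]) x y, J (c *: x + y) = c^* *: J x + J y),
      (forall x y, braket (J x) (J y) = braket y x) &
      range J = setT].

(* the graph of the closure S of x Omega |-> x^* Omega, x in M *)
Definition tomita (M : set (bop H)) (Omega : H) : set (H * H) :=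
  closure [set u : H * H |
    exists2 x : bop H, M x & u = (x Omega, adjoint x Omega)].

(* S = J Delta^{1/2} is the polar decomposition of S; J is antiunitary because
   S is injective with dense range. *)
Definition modular_conjugation (M : set (bop H)) (Omega : H) (J : H -> H) :
  Prop :=
  antiunitary J /\
  exists sqrtDelta : set (H * H), positive_selfadjoint sqrtDelta /\
    tomita M Omega = [set u | exists2 v, sqrtDelta v & u = (v.1, J v.2)].

(* J is unique, by the uniqueness of polar decompositions. *)
Definition natural_cone (M : set (bop H)) (Omega : H) : set H :=
  [set xi | exists2 J, modular_conjugation M Omega J &
    closure [set eta | exists2 x : bop H, M x & eta = x (J (x (J Omega)))] xi].

End modular.

(* Main.v *)
Require Import Defs.
From HB Require Import structures.
From mathcomp Require Import all_boot all_order all_algebra.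
From mathcomp Require Import all_classical all_reals all_analysis.
From mathcomp Require Import complex.

Import Order.TTheory GRing.Theory Num.Theory.
Import numFieldNormedType.Exports.

Local Open Scope classical_set_scope.
Local Open Scope ring_scope.

(** The modular objects of [(M, Omega)] are canonical, so a unitary [W] carries
    the natural cone of [(M, Omega)] onto that of [(W M W^*, W Omega)]; no
    modular theory is needed beyond this. For [W = 1 (x) U_B] one has
    [W Omega = Omega], because [rho^(1/2)] is diagonal in the basis [f], and
    conjugation by the transposition [U_B] exchanges left and right
    multiplications, i.e. [pi_B(B)] and its commutant. What remains is that
    [pi_A(A)] and [pi_A(A)''] generate the same von Neumann algebra together
    with [pi_B(B)']. Since [H_B] is finite dimensional, [H] is a finite direct
    sum of copies of [H_A], and operators on [H] are matrices of operators on
    [H_A]; those commuting with [pi_A(A) (x) 1] have entries in [pi_A(A)'].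
    [A] need not be unital, and cyclicity of [Omega_A] replaces the unit. *)

(** * Inner products and bounded operators *)

Section Braket.
Context {R : realType} {H : hilbert R}.
Implicit Types (x y z : H) (c : R[i]).

Lemma braketBr x y z : braket x (y - z) = braket x y - braket x z.
Proof. exact: linearBl. Qed.

Lemma braketZr c x y : braket x (c *: y) = c * braket x y.
Proof. exact: linearZl_LR. Qed.

Lemma braketZl c x y : braket (c *: x) y = c^* * braket x y.
Proof. exact: linearZr_LR. Qed.

Lemma braket_sumr (I : finType) x (y : I -> H) :
  braket x (\sum_i y i) = \sum_i braket x (y i).
Proof. exact: linear_sumlz. Qed.

Lemma braket_suml (I : finType) (x : I -> H) y :
  braket (\sum_i x i) y = \sum_i braket (x i) y.
Proof. exact: linear_sumr. Qed.

Lemma braketC x y : braket x y = (braket y x)^*.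
Proof. by rewrite /braket hermC expr0 mul1r. Qed.

Lemma braket_norm x : braket x x = `|x| ^+ 2.
Proof. exact: innerE. Qed.

Lemma braket_inj x y : (forall z, braket z x = braket z y) -> x = y.
Proof.
move=> xy; apply/eqP; rewrite -subr_eq0 -normr_eq0 -sqrf_eq0 -braket_norm.
by rewrite braketBr xy subrr.
Qed.

End Braket.

Section Operators.
Context {R : realType} {H : hilbert R}.
Implicit Types S T : bop H.

Lemma bopD T x y : T (x + y) = T x + T y.
Proof. by have := (bopE T).1 1 x y; rewrite !scale1r. Qed.

Lemma bop0 T : T 0 = 0.
Proof. by apply: (addrI (T 0)); rewrite -bopD !addr0. Qed.

Lemma bopZ T c x : T (c *: x) = c *: T x.
Proof. by have := (bopE T).1 c x 0; rewrite bop0 !addr0. Qed.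

Lemma bop_sum T (I : finType) (x : I -> H) : T (\sum_i x i) = \sum_i T (x i).
Proof. exact: (big_morph T (bopD T) (bop0 T)). Qed.

Lemma bop_eq {S T} : S =1 T -> S = T.
Proof. by move=> /funext ST; exact: val_inj. Qed.

Lemma bop_eqP {S T} : S = T <-> S =1 T.
Proof. by split=> [->//|]; exact: bop_eq. Qed.

Lemma bop_commE {S T} x : bop_comp S T = bop_comp T S -> S (T x) = T (S x).
Proof. by move=> /bop_eqP /(_ x). Qed.

Lemma bop_sumE (I : finType) (T : I -> bop H) x : (\sum_i T i) x = \sum_i T i x.
Proof. exact: (big_morph (fun T : bop H => T x)). Qed.

(** [adjoint] is a choice with default [0], and its defining identity has at most one solution
    because the inner product is nondegenerate; any solution found by hand is therefore the chosen
    one. *)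
Lemma adjoint_eq {S T} :
  (forall x y, braket (T x) y = braket x (S y)) -> adjoint T = S.
Proof.
move=> TS; apply/bop_eq => y; apply: braket_inj => x.
by rewrite -TS -(@xgetPex _ 0 [set S' : bop H | _] (ex_intro _ S TS)).
Qed.

End Operators.

Lemma continuous_eq_on_dense {T U : topologicalType} (f g : T -> U) (D : set T) :
  hausdorff_space U -> continuous f -> continuous g ->
  closure D = setT -> (forall x, D x -> f x = g x) -> f =1 g.
Proof.
move=> hU cf cg dD fg x; apply: hU => V W fxV gxW.
have VW : nbhs x (f @^-1` V `&` g @^-1` W).
  by apply: filterI; [exact: cf|exact: cg].
have : closure D x by rewrite dD.
move=> /(_ _ VW) [d [Dd [Vd Wd]]].
by exists (f d); split=> //=; rewrite fg.
Qed.

(** * Coordinates in a Hilbert tensor product with finite dimensional second factor *)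

Section TensorCoordinates.
Context {R : realType} {H1 H2 H : hilbert R} {tau : {bilinear H1 -> H2 -> H}}.
Hypothesis tau_tensor : hilbert_tensor tau.
Context {I : finType} {e : I -> H2}.
Hypothesis e_orthonormal : forall i j, braket (e i) (e j) = (i == j)%:R.
Hypothesis e_basis : forall y, y = \sum_i braket (e i) y *: e i.

(** General families [u] and [u'] replace [e] so that the formula also applies to the image of [e]
    under an isometry. *)
Lemma braket_tensor_sum (x x' : I -> H1) (u u' : I -> H2) :
  (forall i j, braket (u i) (u' j) = (i == j)%:R) ->
  braket (\sum_i tau (x i) (u i)) (\sum_i tau (x' i) (u' i)) =
  \sum_i braket (x i) (x' i).
Proof.
move=> uu'; rewrite braket_suml; apply: eq_bigr => i _.
rewrite braket_sumr (bigD1 i)//= big1 ?addr0.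
  by rewrite (tensor_braket tau_tensor) uu' eqxx mulr1.
by move=> j ji; rewrite (tensor_braket tau_tensor) uu' eq_sym (negPf ji) mulr0.
Qed.

Lemma tensor_coord (x : H1) (y : H2) :
  tau x y = \sum_i tau (braket (e i) y *: x) (e i).
Proof.
rewrite [in LHS](e_basis y) linear_sumr; apply: eq_bigr => i _.
by rewrite linearZl_LR linearZr_LR.
Qed.

(** By Pythagoras, the squared norm of the sum is the sum of the squared norms of the [x j]. This
    bound makes coordinates unique and contractive, and Cauchy along convergent sums. *)
Lemma norm_le_tensor_sum (x : I -> H1) i :
  `|x i| <= `|\sum_i tau (x i) (e i)|.
Proof.
rewrite -(@ler_pXn2r _ 2)// ?nnegrE// -!braket_norm braket_tensor_sum//.
rewrite (bigD1 i)//= lerDl sumr_ge0// => j _.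
by rewrite braket_norm exprn_ge0.
Qed.

Lemma tensor_continuousl (y : H2) : continuous (tau ^~ y).
Proof.
have lin : linear (tau ^~ y) by move=> k u v; rewrite linearPl.
pose g := GRing.isLinear.Build _ _ _ _ _ lin.
pose F : {linear H1 -> H} := HB.pack (tau ^~ y) g.
apply: (@bounded_linear_continuous _ _ _ F); apply/linear_boundedP.
near=> r => x /=.
have -> : `|tau x y| = `|x| * `|y|.
  apply/eqP; rewrite -(@eqrXn2 _ 2)// ?mulr_ge0// exprMn -!braket_norm.
  by rewrite (tensor_braket tau_tensor).
by rewrite mulrC ler_wpM2r//; near: r; exact: nbhs_pinfty_ge.
Unshelve. all: by end_near. Qed.

(* The sums [\sum_i tau (x i) (e i)] are dense, and form a complete subspace. *)
Lemma tensor_coordinates_exist (z : H) :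
  exists x : I -> H1, z = \sum_i tau (x i) (e i).
Proof.
pose Phi (x : I -> H1) := \sum_i tau (x i) (e i).
(* Expanding the second factors in [e] turns any finite sum of elementary tensors into a value of
   [Phi], so the range of [Phi] is dense. *)
have Phi_dense V : nbhs z V -> exists x, V (Phi x).
  move=> zV; have : closure [set z | exists (m : nat) (x : 'I_m -> H1)
      (y : 'I_m -> H2), z = \sum_i tau (x i) (y i)] z.
    by rewrite (tensor_dense tau_tensor).
  move=> /(_ V zV) [_ [[m [x [y ->]]] V_xy]].
  exists (fun i => \sum_j braket (e i) (y j) *: x j).
  rewrite /Phi; under eq_bigr do rewrite linear_sumlz.
  by rewrite exchange_big/=; under eq_bigr do rewrite -tensor_coord.
(* The neighbourhoods of [z] pulled back along [Phi] form a filter, proper by density. Its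
   coordinates are Cauchy, hence converge in the complete space [H1], and their limits are
   coordinates of [z]. *)
pose F := filter_from (nbhs z) (fun V => Phi @^-1` V).
have FF : ProperFilter F.
  apply: filter_from_proper => [|V /Phi_dense[x Vx]]; last by exists x.
  apply: filter_from_filter; first by exists setT; exact: filterT.
  move=> V W zV zW; exists (V `&` W); first exact: filterI.
  by rewrite preimage_setI.
have F_Phi : Phi @ F --> z by move=> V zV; exists V.
have F_coord i : cvg ((fun x => x i) @ F).
  apply: cauchy_cvg; apply: cauchy_exP => eps eps0.
  have eps20 : 0 < eps / 2 by rewrite divr_gt0.
  have [x0 zx0] := Phi_dense _ (nbhsx_ballx z _ eps20).
  exists (x0 i), (ball z (eps / 2)) => [|x zx]; first exact: nbhsx_ballx.
  have := ball_splitr zx0 zx; rewrite -!ball_normE/=.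
  apply: le_lt_trans; rewrite -sumrB.
  under eq_bigr do rewrite -linearBl.
  exact: (norm_le_tensor_sum (fun i => x0 i - x i)).
exists (fun i => lim ((fun x => x i) @ F)).
apply: (cvg_unique (@norm_hausdorff _ _) F_Phi).
apply: (cvg_big (op := +%R) add_continuous) => i _.
exact: (cvg_comp _ _ (F_coord i) (@tensor_continuousl (e i) _)).
Qed.

(** Coordinates are unique by [norm_le_tensor_sum]. Uniqueness gives linearity and the value on
    elementary tensors, and the same bound gives continuity. *)
Lemma tensor_coordinates : exists c : I -> H -> H1,
  [/\ forall z, z = \sum_i tau (c i z) (e i),
      forall i, linear (c i) /\ continuous (c i) &
      forall i x y, c i (tau x y) = braket (e i) y *: x].
Proof.
have [c cE] := choice tensor_coordinates_exist.
have c_uniq z (x : I -> H1) i : z = \sum_i tau (x i) (e i) -> c z i = x i.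
  move=> zE; apply/eqP; rewrite -subr_eq0 -normr_le0.
  apply: le_trans (norm_le_tensor_sum (fun i => c z i - x i) i) _.
  under eq_bigr do rewrite linearBl.
  by rewrite sumrB -cE -zE subrr normr0.
have lin i : linear (c ^~ i).
  move=> k u v; apply: (c_uniq _ (fun i => k *: c u i + c v i)).
  under eq_bigr do rewrite linearPl.
  by rewrite big_split/= -scaler_sumr -!cE.
exists (fun i => c ^~ i); split=> [//|i|i x y].
- split; first exact: lin.
  pose g := GRing.isLinear.Build _ _ _ _ _ (lin i).
  pose F : {linear H -> H1} := HB.pack (c ^~ i) g.
  apply: (@bounded_linear_continuous _ _ _ F); apply/linear_boundedP.
  near=> r => z /=; apply: (@le_trans _ _ `|z|).
    by rewrite [leRHS](congr1 _ (cE z)); exact: norm_le_tensor_sum.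
  by rewrite ler_peMl//; near: r; exact: nbhs_pinfty_ge.
- by apply: (c_uniq _ (fun i => braket (e i) y *: x)); exact: tensor_coord.
Unshelve. all: by end_near. Qed.

Lemma tensor_op_ext (S T : bop H) :
  (forall x i, S (tau x (e i)) = T (tau x (e i))) -> S = T.
Proof.
have [c [cE _ _]] := tensor_coordinates.
move=> ST; apply: bop_eq => z; rewrite (cE z) !bop_sum.
by apply: eq_bigr => i _; exact: ST.
Qed.

(** Since [tensor_op] is defined by choice, only existence is at stake: a suitable operator is
    assembled from the coordinates of [z] and the images [T (e i)]. *)
Lemma tensor_opE (S : bop H1) (T : bop H2) x y :
  tensor_op tau S T (tau x y) = tau (S x) (T y).
Proof.
have [c [cE c_lc cM]] := tensor_coordinates.
suff W_ex : exists W : bop H, forall x y, W (tau x y) = tau (S x) (T y).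
  exact: (xgetPex 0 W_ex).
pose W z := \sum_i tau (S (c i z)) (T (e i)).
have W_lc : linear W /\ continuous W.
  split=> [k u v|z].
    rewrite /W scaler_sumr -big_split/=; apply: eq_bigr => i _.
    by rewrite (c_lc i).1 (bopE S).1 linearPl.
  apply: (cvg_big (op := +%R) add_continuous) => i _.
  have c_cvg := cvg_comp _ _ ((c_lc i).2 z) ((bopE S).2 _).
  exact: (cvg_comp _ _ c_cvg (@tensor_continuousl (T (e i)) _)).
exists (mkbop W_lc) => x' y' /=; rewrite /W [in RHS](e_basis y') bop_sum.
rewrite linear_sumr; apply: eq_bigr => i _.
by rewrite cM !bopZ linearZl_LR linearZr_LR.
Qed.

Lemma tensor_op_comp (S S' : bop H1) (T T' : bop H2) :
  bop_comp (tensor_op tau S T) (tensor_op tau S' T') =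
  tensor_op tau (bop_comp S S') (bop_comp T T').
Proof. by apply: tensor_op_ext => x i /=; rewrite !tensor_opE. Qed.

Lemma tensor_op_isometry (U : bop H2) :
  (forall x y, braket (U x) (U y) = braket x y) ->
  forall x y, braket (tensor_op tau (bop_id H1) U x)
    (tensor_op tau (bop_id H1) U y) = braket x y.
Proof.
have [c [cE _ _]] := tensor_coordinates.
move=> U_iso x y; rewrite (cE x) (cE y) !bop_sum.
under eq_bigr do rewrite tensor_opE.
under [X in braket _ X]eq_bigr do rewrite tensor_opE.
by rewrite !braket_tensor_sum// => i j; rewrite U_iso.
Qed.

(* An operator commuting with [a (x) 1] for all [a] in [X] has its slices, i.e.
   its matrix entries with respect to [e], in the commutant of [X]. *)
Lemma commutant_tensor_bicommutant (X : set (bop H1)) (N : set (bop H2))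
    (Omega : H1) :
  closure [set x | exists2 a, X a & x = a Omega] = setT -> N (bop_id H2) ->
  commutant [set W | exists S T,
    [/\ bicommutant X S, N T & W = tensor_op tau S T]] =
  commutant [set W | exists S T, [/\ X S, N T & W = tensor_op tau S T]].
Proof.
have [c [cE c_lc cM]] := tensor_coordinates.
have c_sum i (J : finType) (z : J -> H) : c i (\sum_j z j) = \sum_j c i (z j).
  have c0 : c i 0 = 0 by rewrite -(linear0l tau 0) cM scaler0.
  apply: (big_morph (c i)) => [u v|//].
  by have := (c_lc i).1 1 u v; rewrite !scale1r.
have c_op S i z : c i (tensor_op tau S (bop_id H2) z) = S (c i z).
  rewrite [in LHS](cE z) bop_sum c_sum (bigD1 i)//= big1 ?addr0.
    by rewrite tensor_opE cM e_orthonormal eqxx scale1r.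
  move=> j ji; rewrite tensor_opE cM e_orthonormal eq_sym (negPf ji).
  by rewrite scale0r.
move=> X_cyclic N1; apply/seteqP; split=> Z Zcomm W [S [T [XS NT ->]]].
  by apply: Zcomm; exists S, T; split=> // S' S'X; rewrite S'X.
have slice_lc i j : linear (fun x => c i (Z (tau x (e j)))) /\
    continuous (fun x => c i (Z (tau x (e j)))).
  split=> [k u v|x]; first by rewrite linearPl (bopE Z).1 (c_lc i).1.
  have Z_cvg := cvg_comp _ _ (@tensor_continuousl (e j) x) ((bopE Z).2 _).
  exact: (cvg_comp _ _ Z_cvg ((c_lc i).2 _)).
have slice_comm i j : commutant X (mkbop (slice_lc i j)).
  move=> a Xa; apply: bop_eq => x /=; rewrite -c_op.
  have /bop_eqP /(_ (tau x (e j)))/= -> :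
    bop_comp (tensor_op tau a (bop_id H2)) Z =
    bop_comp Z (tensor_op tau a (bop_id H2)).
    by apply: Zcomm; exists a, (bop_id H2).
  by rewrite tensor_opE.
(* Comparing coordinates reduces this to [S], in the bicommutant of [X], commuting with the slices
   of [Z]. *)
have ZS : bop_comp (tensor_op tau S (bop_id H2)) Z =
    bop_comp Z (tensor_op tau S (bop_id H2)).
  apply: tensor_op_ext => x j /=; rewrite tensor_opE.
  rewrite (cE (tensor_op _ _ _ _)) [RHS]cE; apply: eq_bigr => i _.
  rewrite c_op; congr (tau _ _).
  by have /bop_eqP /(_ x)/= <- := XS _ (slice_comm i j).
(* [X] need not contain the identity, so [Z] is tested on the vectors [tau (a Omega) (e j)] with [a]
   in [X], and cyclicity extends the result by continuity. On them, (1 (x) T) Z (a (x) 1) = (1 (x)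
   T) (a (x) 1) Z = (a (x) T) Z = Z (a (x) T). *)
have ZT : bop_comp (tensor_op tau (bop_id H1) T) Z =
    bop_comp Z (tensor_op tau (bop_id H1) T).
  apply: tensor_op_ext => x j /=; rewrite tensor_opE/=.
  pose l x := tensor_op tau (bop_id H1) T (Z (tau x (e j))).
  pose r x := Z (tau x (T (e j))).
  apply: (@continuous_eq_on_dense _ _ l r _ (@norm_hausdorff _ _) _ _ X_cyclic).
  - move=> u; have Z_cvg := cvg_comp _ _ (@tensor_continuousl (e j) u)
      ((bopE Z).2 _).
    exact: (cvg_comp _ _ Z_cvg ((bopE _).2 _)).
  - by move=> u; exact: (cvg_comp _ _ (@tensor_continuousl _ u) ((bopE Z).2 _)).
  move=> _ [a Xa ->]; rewrite /l /r.
  have Z1 : bop_comp (tensor_op tau a (bop_id H2)) Z =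
    bop_comp Z (tensor_op tau a (bop_id H2)).
    by apply: Zcomm; exists a, (bop_id H2).
  have ZaT : bop_comp (tensor_op tau a T) Z = bop_comp Z (tensor_op tau a T).
    by apply: Zcomm; exists a, T.
  have <- : tensor_op tau a (bop_id H2) (tau Omega (e j)) =
    tau (a Omega) (e j) by rewrite tensor_opE.
  have /bop_eqP /(_ (tau Omega (e j)))/= <- := Z1.
  have /bop_eqP := tensor_op_comp (bop_id H1) a T (bop_id H2).
  move=> /(_ (Z (tau Omega (e j))))/= ->.
  rewrite (_ : bop_comp _ a = a); last exact: bop_eq.
  rewrite (_ : bop_comp T _ = T); last exact: bop_eq.
  by have /bop_eqP /(_ (tau Omega (e j)))/= -> := ZaT; rewrite tensor_opE.
have -> : tensor_op tau S T =
    bop_comp (tensor_op tau S (bop_id H2)) (tensor_op tau (bop_id H1) T).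
  by rewrite tensor_op_comp; congr tensor_op; exact: bop_eq.
apply: bop_eq => z /=; move/bop_eqP: ZT => /(_ z)/= ->.
by move/bop_eqP: ZS => /(_ (tensor_op tau (bop_id H1) T z))/= ->.
Qed.

End TensorCoordinates.

(** Commuting with [Z] is a linear condition, so passing from simple tensors to their finite sums
    leaves the commutant unchanged. *)
Lemma commutant_tensor_image {R : realType} {H1 H2 H : hilbert R}
    (tau : {bilinear H1 -> H2 -> H}) (A B : lmodType R[i]) (pi1 : A -> bop H1)
    (pi2 : B -> bop H2) :
  commutant (tensor_image tau pi1 pi2) =
  commutant [set W | exists S T,
    [/\ range pi1 S, range pi2 T & W = tensor_op tau S T]].
Proof.
apply/seteqP; split=> Z Zcomm W.
  move=> [_ [_ [[a _ <-] [b _ <-] ->]]]; apply: Zcomm.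
  by exists 1%N, (fun=> a), (fun=> b); rewrite big_ord1.
move=> [m [a [b ->]]]; apply: bop_eq => z /=; rewrite !bop_sumE bop_sum.
apply: eq_bigr => i _.
suff /bop_eqP /(_ z) : bop_comp (tensor_op tau (pi1 (a i)) (pi2 (b i))) Z =
  bop_comp Z (tensor_op tau (pi1 (a i)) (pi2 (b i))) by [].
by apply: Zcomm; exists (pi1 (a i)), (pi2 (b i)); split=> //; eexists.
Qed.

(** * Transport of commutants, modular objects and natural cones by a unitary *)

Lemma closure_preimage_homeo {T U : topologicalType} (f : T -> U) (g : U -> T)
    (A : set U) : continuous f -> continuous g -> cancel f g -> cancel g f ->
  closure (f @^-1` A) = f @^-1` closure A.
Proof.
move=> cf cg fK gK; apply/seteqP; split=> x Ax V xV.
  by have [y [Ay Vy]] := Ax _ (cf x V xV); exists (f y).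
have [|y [Ay Vy]] := Ax (g @^-1` V); first by apply: cg; rewrite fK.
by exists (g y); split=> //=; rewrite gK.
Qed.

Section SpatialIsomorphism.
Context {R : realType} {H : hilbert R}.
Implicit Types (T U V : bop H) (M X : set (bop H)) (Omega : H).

(** For [V] inverse to [U] this is conjugation by [U]. The inverse is an explicit argument, so that
    swapping [U] and [V] yields the inverse conjugation. *)
Definition conj_op U V T : bop H := bop_comp U (bop_comp T V).

Lemma conj_opK {U V} : cancel U V -> cancel V U ->
  cancel (conj_op U V) (conj_op V U).
Proof. by move=> UK VK T; apply: bop_eq => x /=; rewrite !UK. Qed.

(* [conj_op V U @^-1` X] is the set of all [U T V] with [T] in [X]. *)
Lemma commutant_conj U V X : cancel U V -> cancel V U ->
  commutant (conj_op V U @^-1` X) = conj_op V U @^-1` commutant X.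
Proof.
move=> UK VK; apply/seteqP; split=> T TX S XS; apply: bop_eq => x.
  have SX : (conj_op V U @^-1` X) (conj_op U V S) by rewrite /= conj_opK.
  by have /(congr1 V) := bop_commE (U x) (TX _ SX); rewrite /= !UK.
by have /(congr1 U) := bop_commE (V x) (TX _ XS); rewrite /= !VK.
Qed.

Lemma bicommutant_conj U V X : cancel U V -> cancel V U ->
  bicommutant (conj_op V U @^-1` X) = conj_op V U @^-1` bicommutant X.
Proof. by move=> UK VK; rewrite /bicommutant !commutant_conj. Qed.

Section Isometry.
Context {U V : bop H}.
Hypotheses (UK : cancel U V) (VK : cancel V U).
Hypothesis U_iso : forall x y, braket (U x) (U y) = braket x y.

Lemma isometry_inv x y : braket (V x) (V y) = braket x y.
Proof. by rewrite -U_iso !VK. Qed.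

Lemma isometry_adjl x y : braket (U x) y = braket x (V y).
Proof. by rewrite -{1}(VK y) U_iso. Qed.

Lemma isometry_adjr x y : braket x (U y) = braket (V x) y.
Proof. by rewrite -{1}(VK x) U_iso. Qed.

Lemma adjoint_conj_of_exists T :
  (exists S : bop H, forall x y, braket (T x) y = braket x (S y)) ->
  adjoint (conj_op U V T) = conj_op U V (adjoint T).
Proof.
move=> [S TS]; rewrite (adjoint_eq TS); apply: adjoint_eq => x y /=.
by rewrite isometry_adjl TS isometry_adjr.
Qed.

(** The left side generates the cone for the transported algebra, the conjugation [U \o J \o V] and
    the vector [U Omega]. Writing [x] as a conjugate of an element of [M] makes all inner products
    [V U] cancel. *)
Lemma natural_cone_base_conj M J Omega :
  [set eta | exists2 x : bop H, (conj_op V U @^-1` M) x &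
    eta = x (U (J (V (x (U (J (V (U Omega)))))))) ] =
  V @^-1` [set eta | exists2 x : bop H, M x & eta = x (J (x (J Omega)))].
Proof.
apply/seteqP; split=> eta.
  by move=> [x Mx ->]; exists (conj_op V U x) => //=; rewrite !UK.
move=> [x Mx Veta]; exists (conj_op U V x); first by rewrite /= conj_opK.
by rewrite /= !UK -Veta VK.
Qed.

(** The new relation is the graph of U D V; each clause follows from [U] and [V] being mutually
    adjoint isometries. *)
Lemma positive_selfadjoint_conj (D : set (H * H)) : positive_selfadjoint D ->
  positive_selfadjoint [set u | D (V u.1, V u.2)].
Proof.
move=> [D_sa D_single D_pos]; split.
- apply/seteqP; split=> [u Du v Dv|u Du] /=.
    rewrite -!(isometry_inv _ v.1) -!(isometry_inv _ v.2).
    by move: Du; rewrite /= {1}D_sa => /(_ _ Dv).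
  rewrite D_sa => w Dw /=.
  rewrite -!isometry_adjr.
  by apply: (Du (U w.1, U w.2)); rewrite /= !UK -surjective_pairing.
- by move=> y; rewrite /= bop0 => /D_single/(congr1 U); rewrite VK bop0.
- by move=> u Du; rewrite -isometry_inv; exact: D_pos Du.
Qed.

Lemma antiunitary_conj J : antiunitary J -> antiunitary (U \o J \o V).
Proof.
move=> [J_lin J_iso J_surj]; split=> [c x y|x y|].
- by rewrite /= bopD bopZ J_lin bopD bopZ.
- by rewrite /= U_iso J_iso isometry_inv.
- rewrite -subTset => y _; have : [set: H] (V y) by [].
  by rewrite -{1}J_surj => -[x _ Jx]; exists (U x) => //=; rewrite UK Jx VK.
Qed.

End Isometry.
End SpatialIsomorphism.

Section SpatialTransport.
Context {R : realType} {H : hilbert R}.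
Context {U V : bop H}.
Hypotheses (UK : cancel U V) (VK : cancel V U).
Hypothesis U_iso : forall x y, braket (U x) (U y) = braket x y.

(** The case split handles the default value of [adjoint]: if no operator satisfies the adjoint
    identity for [T], none does for its conjugate, and both sides are [0]. *)
Lemma adjoint_conj T : adjoint (conj_op U V T) = conj_op U V (adjoint T).
Proof.
have V_iso := isometry_inv VK U_iso.
have [T_ex|T_nex] :=
  pselect (exists S : bop H, forall x y, braket (T x) y = braket x (S y)).
  exact: adjoint_conj_of_exists.
rewrite /adjoint !xgetPN.
- by apply: bop_eq => x /=; rewrite bop0.
- by move=> S TS; apply: T_nex; exists S.
- move=> S TS; apply: T_nex; exists (conj_op V U S) => x y /=.
  rewrite (isometry_adjr UK V_iso) -TS /=.
  by rewrite UK (isometry_adjl VK U_iso) UK.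
Qed.

(** Applying [U] to both components is a homeomorphism of [H * H], so it passes through the closure;
    on the generating pairs [adjoint_conj] suffices. *)
Lemma tomita_conj M Omega :
  tomita (conj_op V U @^-1` M) (U Omega) =
  [set u | tomita M Omega (V u.1, V u.2)].
Proof.
pose pair_map (W : bop H) (u : H * H) := (W u.1, W u.2).
have pair_cont W : continuous (pair_map W).
  move=> u; apply: cvg_pair; apply: cvg_comp; [exact: cvg_fst|
    exact: (bopE W).2|exact: cvg_snd|exact: (bopE W).2].
have pair_can (W W' : bop H) : cancel W W' -> cancel (pair_map W) (pair_map W').
  by move=> WK [x y]; rewrite /pair_map /= !WK.
rewrite -[RHS]/(pair_map V @^-1` tomita M Omega) /tomita.
rewrite -(closure_preimage_homeo _ (pair_map U))//; last 2 first.
- exact: pair_can.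
- exact: pair_can.
congr closure; apply/seteqP; split=> u.
  move=> [x Mx ->]; exists (conj_op V U x) => //.
  have -> : adjoint x = conj_op U V (adjoint (conj_op V U x)).
    by rewrite -adjoint_conj conj_opK.
  by rewrite /pair_map /= !UK.
move=> [x Mx [u1 u2]]; exists (conj_op U V x); first by rewrite /= conj_opK.
rewrite adjoint_conj /= !UK -u1 -u2 !VK.
by case: u {u1 u2}.
Qed.

(** Conjugating both factors of the polar decomposition S = J D gives U S V = (U J V) (U D V), again
    of the required form. *)
Lemma modular_conjugation_conj {M Omega J} : modular_conjugation M Omega J ->
  modular_conjugation (conj_op V U @^-1` M) (U Omega) (U \o J \o V).
Proof.
move=> [J_au [D [D_psa DE]]]; split; first exact: antiunitary_conj.
exists [set u | D (V u.1, V u.2)]; split; first exact: positive_selfadjoint_conj.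
rewrite tomita_conj DE; apply/seteqP; split=> u /=.
  move=> [v Dv [u1 u2]]; exists (U v.1, U v.2).
    by rewrite /= !UK -surjective_pairing.
  by rewrite /= UK -u1 -u2 !VK; case: u {u1 u2}.
by move=> [v Dv ->]; exists (V v.1, V v.2) => //=; rewrite UK.
Qed.

Lemma natural_cone_conj_sub {M Omega xi} : natural_cone M Omega xi ->
  natural_cone (conj_op V U @^-1` M) (U Omega) (U xi).
Proof.
move=> [J /modular_conjugation_conj J_mod xiP]; exists (U \o J \o V) => //=.
rewrite natural_cone_base_conj//.
rewrite (closure_preimage_homeo _ U)//=; first by rewrite UK.
- exact: (bopE V).2.
- exact: (bopE U).2.
Qed.

End SpatialTransport.

Lemma natural_cone_conj {R : realType} {H : hilbert R} {U V : bop H} M Omega :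
  cancel U V -> cancel V U ->
  (forall x y, braket (U x) (U y) = braket x y) ->
  U @` natural_cone M Omega = natural_cone (conj_op V U @^-1` M) (U Omega).
Proof.
move=> UK VK U_iso; apply/seteqP; split=> [_ [xi xiP <-]|xi xiP].
  exact: natural_cone_conj_sub.
exists (V xi); last exact: VK.
(* The reverse inclusion is the forward one for the inverse unitary [V]. *)
have := natural_cone_conj_sub VK UK (isometry_inv VK U_iso) xiP.
rewrite UK -comp_preimage (_ : _ \o _ = id) ?preimage_id//.
by apply/funext => T; exact: (conj_opK UK VK).
Qed.

(** * Matrix entries, traces and positive square roots *)

Section MatrixUnits.
Context {R : realType} {K : hilbert R} {n : nat} {f : 'I_n -> K}.
Hypothesis f_basis : orthonormal_basis f.

Lemma bop_eq_entries (S T : bop K) :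
  (forall k l, braket (f k) (S (f l)) = braket (f k) (T (f l))) -> S = T.
Proof.
move=> ST; apply: bop_eq => x; rewrite (f_basis.2 x) !bop_sum.
apply: eq_bigr => l _; rewrite !bopZ; congr (_ *: _).
rewrite (f_basis.2 (S _)) [RHS](f_basis.2 (T _)).
by apply: eq_bigr => k _; rewrite ST.
Qed.

Lemma adjoint_ketbra (x y : K) : adjoint (ketbra x y) = ketbra y x.
Proof.
by apply: adjoint_eq => u v /=; rewrite braketZl braketZr -braketC mulrC.
Qed.

Lemma trace_ketbra_comp (x y : K) (T : bop K) :
  trace f (bop_comp (ketbra x y) T) = braket y (T x).
Proof.
have T_adj : braket y (T x) = \sum_k braket y (T (f k)) * braket (f k) x.
  rewrite [in LHS](f_basis.2 x) bop_sum braket_sumr.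
  by apply: eq_bigr => k _; rewrite bopZ braketZr mulrC.
by rewrite T_adj; apply: eq_bigr => k _ /=; rewrite braketZr.
Qed.

End MatrixUnits.

(** The vector [v], the difference of the two sides, is mapped by [s] to [- sqrtC c *: v];
    positivity of [s] and [c > 0] then force [v = 0]. *)
Lemma positive_sqrt_eigenvector {R : realType} {K : hilbert R} (s : bop K)
    (x : K) (c : R[i]) :
  positive_op s -> 0 < c -> s (s x) = c *: x -> s x = sqrtC c *: x.
Proof.
move=> s_pos c_gt0 ssx; apply/eqP; rewrite -subr_eq0.
pose v := s x - sqrtC c *: x.
have sv : s v = - sqrtC c *: v.
  rewrite /v -scaleNr bopD bopZ ssx scalerDr scalerA mulrN mulNr opprK.
  by rewrite -expr2 sqrtCK addrC.
have := s_pos v; rewrite sv braketZr mulNr oppr_ge0 pmulr_rle0 ?sqrtC_gt0//.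
by rewrite braket_norm -/v -(normr_eq0 v) -sqrf_eq0 eq_le exprn_ge0// andbT.
Qed.

(** * The Hilbert-Schmidt model of [H_B] and the transposition [UB] *)

Section HilbertSchmidt.
Context {R : realType} {K_B : hilbert R} {n : nat} {f : 'I_n -> K_B}.
Hypothesis f_basis : orthonormal_basis f.
Context {H_B : hilbert R} {piB : {linear bop K_B -> bop H_B}}
  {iota : {linear H_B -> bop K_B}} {UB : bop H_B}.
Hypotheses (iota_bij : bijective iota)
  (iota_braket : forall x y,
    braket x y = trace f (bop_comp (adjoint (iota x)) (iota y)))
  (iota_pi : forall b x, iota (piB b x) = bop_comp b (iota x))
  (UB_unitary : unitary UB)
  (UB_F : forall k l x, iota x = ketbra (f k) (f l) ->
    iota (UB x) = ketbra (f l) (f k)).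

Definition entry (x : H_B) k l : R[i] := braket (f k) (iota x (f l)).

Lemma entry_inj x y : (forall k l, entry x k l = entry y k l) -> x = y.
Proof. by move=> xy; apply: (bij_inj iota_bij); exact: (bop_eq_entries f_basis). Qed.

(** The [e p] are the preimages of the F_kl under [iota]. The trace inner product with F_kl reads
    off the (k, l) entry, which gives both orthonormality and the expansion. *)
Lemma matrix_units : exists e : 'I_n * 'I_n -> H_B,
  [/\ forall p x, braket (e p) x = entry x p.1 p.2,
      forall p, UB (e p) = e (p.2, p.1),
      forall p q, braket (e p) (e q) = (p == q)%:R &
      forall x, x = \sum_p braket (e p) x *: e p].
Proof.
have [g iotaK gK] := iota_bij.
pose e p := g (ketbra (f p.1) (f p.2)).
have e_entry p x : braket (e p) x = entry x p.1 p.2.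
  by rewrite iota_braket gK adjoint_ketbra trace_ketbra_comp.
have e_on p q : braket (e p) (e q) = (p == q)%:R.
  rewrite e_entry /entry gK /= braketZr !f_basis.1 -natrM mulnb.
  by congr (_ %:R); case: p q => [k l] [k' l']; rewrite xpair_eqE andbC (eq_sym l).
exists e; split=> // [p|x].
  by apply: (can_inj iotaK); rewrite (UB_F p.1 p.2) gK.
apply: entry_inj => k l; rewrite -!(e_entry (k, l)) braket_sumr.
rewrite (bigD1 (k, l))//= big1 ?addr0.
  by rewrite braketZr e_on eqxx mulr1.
by move=> p pkl; rewrite braketZr e_on eq_sym (negPf pkl) mulr0.
Qed.

(** The entry on the right is the inner product of [e (l, k)] with [x]; the isometry [UB] may be
    applied to both arguments, and it sends [e (l, k)] to [e (k, l)]. *)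
Lemma entry_transpose x k l : entry (UB x) k l = entry x l k.
Proof.
have [e [e_entry Ue _ _]] := matrix_units.
by rewrite -(e_entry (k, l)) -(e_entry (l, k)) -[RHS]UB_unitary.1 Ue.
Qed.

Lemma transposeK : cancel UB UB.
Proof. by move=> x; apply: entry_inj => k l; rewrite !entry_transpose. Qed.

Lemma entry_pi b x k l :
  entry (piB b x) k l = \sum_m braket (f k) (b (f m)) * entry x m l.
Proof.
rewrite /entry iota_pi /= [in LHS](f_basis.2 (iota x (f l))) bop_sum braket_sumr.
by apply: eq_bigr => m _; rewrite bopZ braketZr mulrC.
Qed.

(* Transposition exchanges left and right multiplications of matrices. *)
Lemma transpose_pi : conj_op UB UB @^-1` range piB = commutant (range piB).
Proof.
apply/seteqP; split=> T.
  move=> [b _ bT] _ [c _ <-]; apply: bop_eq => x.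
  (* In matrix form [T z] is [z] times the transpose of [b], a right multiplication, which commutes
     with left ones. *)
  have Tb z k l : entry (T z) k l =
      \sum_m braket (f l) (b (f m)) * entry z k m.
    have -> : T z = UB (piB b (UB z)) by rewrite bT /= !transposeK.
    rewrite entry_transpose entry_pi.
    by apply: eq_bigr => m _; rewrite entry_transpose.
  apply: entry_inj => k l /=; rewrite entry_pi Tb.
  under eq_bigr do rewrite Tb mulr_sumr.
  rewrite exchange_big/=; apply: eq_bigr => m _.
  by rewrite entry_pi mulr_sumr; apply: eq_bigr => j _; rewrite mulrCA.
move=> T_comm; have [g iotaK gK] := iota_bij.
(* [g (bop_id K_B)] is the identity matrix viewed in [H_B]. As [T] commutes with left
   multiplications, it is right multiplication by its value there. *)
have Tg z : T z = piB (iota z) (T (g (bop_id K_B))).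
  rewrite (bop_commE _ (T_comm _ _)); last by exists (iota z).
  congr (T _); apply: (can_inj iotaK); rewrite iota_pi gK; exact: bop_eq.
(* The witness is the transpose of the matrix by which [T] multiplies on the right. *)
exists (iota (UB (T (g (bop_id K_B))))) => //.
apply: bop_eq => z; apply: entry_inj => k l /=.
rewrite [RHS]entry_transpose (Tg (UB z)) !entry_pi; apply: eq_bigr => m _.
by rewrite -!/(entry _ _ _) !entry_transpose mulrC.
Qed.

End HilbertSchmidt.

(** * Comparison of the two natural cones *)

Theorem theorem6p2 (R : realType)
  (A : cstarAlg R) (omegaA : A -> R[i])
  (omegaA_state : state omegaA) (omegaA_faithful : faithful omegaA)
  (H_A : hilbert R) (piA : {linear A -> bop H_A}) (OmegaA : H_A)
  (gnsA : gns_triple (cmul A) (@cadj R A) omegaA piA OmegaA)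
  (sepA : separating (bicommutant (range piA)) OmegaA)
  (K_B : hilbert R) (n : nat) (f : 'I_n -> K_B) (rho : bop K_B)
  (f_basis : orthonormal_basis f)
  (f_eigen : forall k, eigenvector rho (f k))
  (rho_pos : positive_op rho) (rho_tr : trace f rho = 1)
  (rho_inv : invertible_op rho)
  (H_B : hilbert R) (piB : {linear bop K_B -> bop H_B}) (OmegaB : H_B)
  (gnsB : gns_triple (@bop_comp R K_B) (@adjoint R K_B)
    (fun b => trace f (bop_comp b rho)) piB OmegaB)
  (iota : {linear H_B -> bop K_B}) (iota_bij : bijective iota)
  (iota_braket : forall x y,
    braket x y = trace f (bop_comp (adjoint (iota x)) (iota y)))
  (iota_pi : forall b x, iota (piB b x) = bop_comp b (iota x))
  (iota_Omega_pos : positive_op (iota OmegaB))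
  (iota_Omega_sqr : bop_comp (iota OmegaB) (iota OmegaB) = rho)
  (UB : bop H_B) (UB_unitary : unitary UB)
  (UB_F : forall k l x, iota x = ketbra (f k) (f l) ->
    iota (UB x) = ketbra (f l) (f k))
  (H : hilbert R) (tau : {bilinear H_A -> H_B -> H})
  (tau_tensor : hilbert_tensor tau) :
  let Omega := tau OmegaA OmegaB in
  let P := natural_cone (bicommutant (tensor_image tau piA piB)) Omega in
  let P' := natural_cone
    (vn_tensor tau (bicommutant (range piA)) (commutant (range piB))) Omega in
  tensor_op tau (bop_id H_A) UB @` P = P'.
Proof.
move=> Omega P P'.
have [e [_ _ e_on e_basis]] := matrix_units f_basis iota_bij iota_braket UB_F.
have UK := transposeK f_basis iota_bij iota_braket UB_unitary UB_F.
have U_pi := transpose_pi f_basis iota_bij iota_braket iota_pi UB_unitary UB_F.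
have W_tau := tensor_opE tau_tensor e_on e_basis.
have W_ext := tensor_op_ext tau_tensor e_on e_basis.
set W := tensor_op tau (bop_id H_A) UB.
have WK : cancel W W.
  apply/(@bop_eqP _ _ (bop_comp W W) (bop_id H)); apply: W_ext => x p /=.
  by rewrite !W_tau /= UK.
have U_Omega : UB OmegaB = OmegaB.
  apply: (entry_inj f_basis iota_bij) => k l.
  rewrite (entry_transpose f_basis iota_bij iota_braket UB_unitary UB_F).
  (* The eigenvalue of [rho] at [f j] is nonnegative by positivity and nonzero by invertibility, so
     the positive square root [iota OmegaB] acts on [f j] by [sqrtC c]. *)
  have s_f j : exists r, iota OmegaB (f j) = r *: f j.
    have [fj0 [c rho_fj]] := f_eigen j.
    have ff1 : braket (f j) (f j) = 1 by rewrite f_basis.1 eqxx.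
    exists (sqrtC c); apply: positive_sqrt_eigenvector => //.
      have := rho_pos (f j); rewrite rho_fj braketZr ff1 mulr1 lt0r => ->.
      rewrite andbT; apply: contra_neq fj0 => c0.
      have [S [Srho _]] := rho_inv.
      have /bop_eqP /(_ (f j))/= <- := Srho.
      by rewrite rho_fj c0 scale0r bop0.
    by rewrite -rho_fj -iota_Omega_sqr.
  have [r rE] := choice s_f.
  rewrite /entry !rE !braketZr !f_basis.1 eq_sym.
  by have [->|_] := eqVneq; rewrite ?mulr0.
have W_Omega : W Omega = Omega by rewrite W_tau U_Omega.
have W_iso := tensor_op_isometry tau_tensor e_on e_basis UB UB_unitary.1.
rewrite /P /P' (natural_cone_conj _ _ WK WK W_iso) W_Omega.
congr (natural_cone _ _); rewrite -bicommutant_conj//.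
rewrite /bicommutant /vn_tensor /bicommutant.
(* It suffices to compare first commutants, and these allow sums of tensors to be replaced by simple
   tensors and the bicommutant of [range piA] by [range piA] itself. *)
congr commutant; rewrite commutant_conj//.
rewrite commutant_tensor_image -commutant_conj//.
rewrite (commutant_tensor_bicommutant tau_tensor e_on e_basis _ _ OmegaA).
(* Conjugation by [W] fixes the first factor of a simple tensor and conjugates the second by [UB],
   so [U_pi] matches the two sets. *)
- congr commutant; apply/seteqP; split=> X.
    move=> [_ [_ [[a _ <-] [b _ <-] XE]]].
    exists (piA a), (conj_op UB UB (piB b)); split=> //.
      by rewrite -U_pi; exists b => //; rewrite conj_opK.
    rewrite -(conj_opK WK WK X) XE; apply: W_ext => x p /=.
    by rewrite !W_tau.
  move=> [_ [T [[a _ <-] T_comm ->]]].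
  move: T_comm; rewrite -U_pi => -[b _ bE].
  exists (piA a), (piB b); split=> //.
  by rewrite bE; apply: W_ext => x p /=; rewrite !W_tau.
- rewrite -(gns_cyclic gnsA); congr closure; apply/seteqP; split=> x.
    by move=> [_ [a _ <-] ->]; exists a.
  by move=> [a _ <-]; exists (piA a) => //; exists a.
- by move=> T _; exact: bop_eq.
Qed.
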